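(* Let $R$ be a Noetherian ring, and let $M$ be a finitely generated torsion-free $R$-module. Then the idealization $A=R\ltimes M$ of $M$ over $R$ is a weakly Arf ring if and only if $R$ is a weakly Arf ring and $M$ is an $\overline{R}$-module.
   Context: Rings are commutative. For a ring $A$, $Q(A)$ denotes its total ring of fractions and $\overline{A}$ the integral closure of $A$ in $Q(A)$. A commutative ring $A$ is called weakly Arf if $yz/x \in A$ whenever $x,y,z\in A$ are such that $x$ is a non-zerodivisor on $A$ and $y/x, z/x \in Q(A)$ are integral over $A$. An $R$-module $M$ is torsion-free if every non-zerodivisor of $R$ is a non-zerodivisor on $M$; then $M$ is regarded as an $R$-submodule of the $Q(R)$-module $Q(R)\otimes_R M$, and ''$M$ is an $\overline{R}$-module'' means $\overline{R}\cdot M = M$ inside $Q(R)\otimes_R M$. The idealization $R\ltimes M$ is $R\oplus M$ as an additive group with multiplication $(a,x)(b,y) = (ab, bx+ay)$. *)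

(* Defs.v *)
From HB Require Import structures.
From mathcomp Require Import all_boot all_algebra generic_quotient ring.
From mathcomp Require Import boolp classical_sets.

Set Implicit Arguments.
Unset Strict Implicit.
Unset Printing Implicit Defensive.

Import GRing.Theory.
Local Open Scope ring_scope.
Local Open Scope classical_set_scope.
Local Open Scope quotient_scope.

Section NonZeroDivisor.
Variable A : comPzRingType.

Definition nonzerodivisor (x : A) : Prop := forall y, x * y = 0 -> y = 0.

Lemma nonzerodivisorE x : nonzerodivisor x <-> GRing.lreg x.
Proof.
split=> [h|h y e]; last by apply: h; rewrite e mulr0.
move=> y z e; apply/eqP; rewrite -subr_eq0; apply/eqP/h.
by rewrite mulrBr e subrr.
Qed.

Definition nzdb : pred A := fun x => `[< nonzerodivisor x >].

Record nzd := Nzd { nzd_val :> A; _ : nzdb nzd_val }.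
HB.instance Definition _ := [isSub for nzd_val].
HB.instance Definition _ := [Choice of nzd by <:].

Lemma nzdP (s : nzd) : nonzerodivisor s.
Proof. by case: s => s /= /asboolP. Qed.

Lemma nzdI (s : nzd) (x y : A) : (s : A) * x = (s : A) * y -> x = y.
Proof.
move=> e; apply/eqP; rewrite -subr_eq0; apply/eqP; apply: (nzdP (s := s)).
by rewrite mulrBr e subrr.
Qed.

Lemma nzd1_subproof : nzdb 1.
Proof. by apply/asboolP => y; rewrite mul1r. Qed.
Definition nzd1 : nzd := Nzd nzd1_subproof.

Lemma nzdM_subproof (s t : nzd) : nzdb ((s : A) * (t : A)).
Proof.
by apply/asboolP => y; rewrite -mulrA => /(nzdP (s := s)) /(nzdP (s := t)).
Qed.
Definition nzdM (s t : nzd) : nzd := Nzd (nzdM_subproof s t).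

End NonZeroDivisor.

Module TotalFrac.
Section TotalFrac.
Variable A : comPzRingType.

Definition dom : Type := (A * nzd A)%type.
HB.instance Definition _ := Choice.on dom.
Implicit Types p q : dom.

(* No extra multiplier is needed since all the denominators are
   non-zerodivisors. *)
Definition equivf p q : bool := p.1 * (q.2 : A) == q.1 * (p.2 : A).

Lemma equivf_refl : reflexive equivf.
Proof. by move=> p; rewrite /equivf. Qed.
Lemma equivf_sym : symmetric equivf.
Proof. by move=> p q; rewrite /equivf eq_sym. Qed.
Lemma equivf_trans : transitive equivf.
Proof.
move=> [b t] [a s] [c u]; rewrite /equivf /= => /eqP h1 /eqP h2.
apply/eqP; apply: (@nzdI _ t).
rewrite mulrA (mulrC (t : A)) h1 mulrA (mulrC (t : A)) -h2.
by rewrite mulrAC.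
Qed.

Canonical equivf_equiv := EquivRel equivf equivf_refl equivf_sym equivf_trans.

Definition type := {eq_quot equivf}.
HB.instance Definition _ : EqQuotient _ equivf type := EqQuotient.on type.
HB.instance Definition _ := Choice.on type.

Definition frac (a : A) (s : nzd A) : type := \pi_type ((a, s) : dom).

Lemma fracE (a b : A) (s t : nzd A) :
  frac a s = frac b t <-> a * (t : A) = b * (s : A).
Proof.
by split=> [/eqmodP/eqP //|e]; apply/eqmodP; apply/eqP.
Qed.

Lemma fracP (x : type) : exists a s, x = frac a s.
Proof. by elim/quotW: x => -[a s]; exists a, s. Qed.

Definition lift1 (h : dom -> type) (x : type) : type := h (repr x).
Definition lift2 (h : dom -> dom -> type) (x y : type) : type :=
  h (repr x) (repr y).

Lemma lift1E (h : dom -> type) :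
  (forall p q, equivf p q -> h p = h q) ->
  forall a s, lift1 h (frac a s) = h (a, s).
Proof.
move=> hh a s; apply: hh; suff /eqmodP : \pi_type (repr (frac a s)) = frac a s by [].
exact: reprK.
Qed.

Lemma lift2E (h : dom -> dom -> type) :
  (forall p p' q q', equivf p p' -> equivf q q' -> h p q = h p' q') ->
  forall a s b t, lift2 h (frac a s) (frac b t) = h (a, s) (b, t).
Proof.
move=> hh a s b t; apply: hh.
  suff /eqmodP : \pi_type (repr (frac a s)) = frac a s by [].
  exact: reprK.
suff /eqmodP : \pi_type (repr (frac b t)) = frac b t by [].
exact: reprK.
Qed.

Definition opp := lift1 (fun p => frac (- p.1) p.2).
Definition add :=
  lift2 (fun p q => frac (p.1 * (q.2 : A) + q.1 * (p.2 : A)) (nzdM p.2 q.2)).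
Definition mul := lift2 (fun p q => frac (p.1 * q.1) (nzdM p.2 q.2)).

Lemma oppE a s : opp (frac a s) = frac (- a) s.
Proof.
rewrite /opp lift1E // => -[b t] [c u] /eqP /= e; apply/fracE.
by rewrite !mulNr e.
Qed.

Lemma addE a s b t :
  add (frac a s) (frac b t) = frac (a * (t : A) + b * (s : A)) (nzdM s t).
Proof.
rewrite /add lift2E // => -[{}a {}s] [a' s'] [{}b {}t] [b' t'] /eqP /= e /eqP /= f.
apply/fracE => /=.
have -> : (a * (t : A) + b * (s : A)) * ((s' : A) * (t' : A)) =
  a * (s' : A) * ((t : A) * (t' : A)) + b * (t' : A) * ((s : A) * (s' : A)).
  by ring.
by rewrite e f; ring.
Qed.

Lemma mulE a s b t : mul (frac a s) (frac b t) = frac (a * b) (nzdM s t).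
Proof.
rewrite /mul lift2E // => -[{}a {}s] [a' s'] [{}b {}t] [b' t'] /eqP /= e /eqP /= f.
by apply/fracE => /=; rewrite mulrACA e f mulrACA.
Qed.

Lemma addA : associative add.
Proof.
move=> x y z; have [a [s ->]] := fracP x; have [b [t ->]] := fracP y.
have [c [u ->]] := fracP z; rewrite !addE; apply/fracE => /=.
ring.
Qed.

Lemma addC : commutative add.
Proof.
move=> x y; have [a [s ->]] := fracP x; have [b [t ->]] := fracP y.
by rewrite !addE; apply/fracE => /=; rewrite addrC (mulrC (s : A) (t : A)).
Qed.

Lemma add0l : left_id (frac 0 (nzd1 A)) add.
Proof.
move=> x; have [a [s ->]] := fracP x; rewrite addE; apply/fracE => /=.
by rewrite mul0r mul1r mulr1 add0r.
Qed.

Lemma addNl : left_inverse (frac 0 (nzd1 A)) opp add.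
Proof.
move=> x; have [a [s ->]] := fracP x; rewrite oppE addE; apply/fracE => /=.
by rewrite mulNr addNr !mul0r.
Qed.

HB.instance Definition _ := GRing.isZmodule.Build type addA addC add0l addNl.

Lemma mulA : associative mul.
Proof.
move=> x y z; have [a [s ->]] := fracP x; have [b [t ->]] := fracP y.
by have [c [u ->]] := fracP z; rewrite !mulE; apply/fracE => /=; rewrite !mulrA.
Qed.

Lemma mulC : commutative mul.
Proof.
move=> x y; have [a [s ->]] := fracP x; have [b [t ->]] := fracP y.
by rewrite !mulE; apply/fracE => /=; rewrite (mulrC a) (mulrC (s : A) (t : A)).
Qed.

Lemma mul1l : left_id (frac 1 (nzd1 A)) mul.
Proof.
move=> x; have [a [s ->]] := fracP x; rewrite mulE; apply/fracE => /=.
by rewrite !mul1r.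
Qed.

Lemma mulDl : left_distributive mul add.
Proof.
move=> x y z; have [a [s ->]] := fracP x; have [b [t ->]] := fracP y.
have [c [u ->]] := fracP z; rewrite (addE a) (mulE (_ + _)).
rewrite (mulE a s c) (mulE b t c) (addE (a * c)); apply/fracE => /=; ring.
Qed.

HB.instance Definition _ :=
  GRing.Zmodule_isComPzRing.Build type mulA mulC mul1l mulDl.

Definition tofrac (a : A) : type := frac a (nzd1 A).

Lemma tofrac_is_zmod_morphism : zmod_morphism tofrac.
Proof.
move=> a b; rewrite /tofrac -[RHS]/(add _ (opp _)) oppE addE.
by apply/fracE => /=; rewrite !mulr1.
Qed.
HB.instance Definition _ :=
  GRing.isZmodMorphism.Build A type tofrac tofrac_is_zmod_morphism.

Lemma tofrac_is_monoid_morphism : monoid_morphism tofrac.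
Proof.
split=> // a b; rewrite /tofrac -[RHS]/(mul _ _) mulE.
by apply/fracE => /=; rewrite !mulr1.
Qed.
HB.instance Definition _ :=
  GRing.isMonoidMorphism.Build A type tofrac tofrac_is_monoid_morphism.

End TotalFrac.
End TotalFrac.
HB.export TotalFrac.

Arguments TotalFrac.type A%_type.
Notation total_frac := TotalFrac.type.
Notation frac := TotalFrac.frac.
Notation tofrac A := (@TotalFrac.tofrac A).

Section TotalFracTheory.
Variable A : comPzRingType.

Lemma tofrac_inj : injective (tofrac A).
Proof. by move=> a b /TotalFrac.fracE /=; rewrite !mulr1. Qed.

Lemma frac_mull (a : A) (s : nzd A) : tofrac A s * frac a s = tofrac A a.
Proof.
rewrite -[LHS]/(TotalFrac.mul _ _) TotalFrac.mulE.
by apply/TotalFrac.fracE => /=; rewrite mulr1 mul1r mulrC.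
Qed.

End TotalFracTheory.

Definition integral (R K : comPzRingType) (f : {rmorphism R -> K}) (z : K) :=
  exists (n : nat) (c : 'I_n -> R), z ^+ n + \sum_(i < n) f (c i) * z ^+ i = 0.

(* [integral] also covers the zero ring, where [integralOver] is not available. *)
Lemma integralE (R K : comNzRingType) (f : {rmorphism R -> K}) (z : K) :
  integral f z <-> integralOver f z.
Proof.
split=> [[n [c e]]|[p p_mon /rootP pz]].
  pose q := \sum_(i < n) c i *: 'X^i : {poly R}.
  have qn : (size q < size ('X^n : {poly R}))%N.
    rewrite size_polyXn ltnS; apply: (leq_trans (size_sum _ _ _)).
    apply/bigmax_leqP => i _; apply: (leq_trans (size_scale_leq _ _)).
    by rewrite size_polyXn.
  exists ('X^n + q); first by rewrite monicE lead_coefDl // lead_coefXn.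
  apply/rootP; rewrite rmorphD /= map_polyXn hornerD hornerXn -{}e; congr (_ + _).
  rewrite rmorph_sum horner_sum; apply: eq_bigr => i _ /=.
  by rewrite map_polyZ map_polyXn hornerZ hornerXn.
have p0 : (0 < size p)%N by rewrite size_poly_gt0 monic_neq0.
exists (size p).-1, (fun i => p`_i); rewrite -[RHS]pz.
rewrite horner_coef size_map_poly_id0; last first.
  by rewrite (monicP p_mon) rmorph1 oner_neq0.
have -> : size p = (size p).-1.+1 by rewrite prednK.
rewrite big_ord_recr /= [RHS]addrC; congr (_ + _).
  by rewrite coef_map /= -[p`__]/(lead_coef p) (monicP p_mon) rmorph1 mul1r.
by apply: eq_bigr => i _; rewrite coef_map.
Qed.

Definition intclosure (A : comPzRingType) : set (total_frac A) :=
  [set z | integral (tofrac A) z].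

Definition weakly_Arf (A : comPzRingType) : Prop :=
  forall (x : nzd A) (y z : A),
    integral (tofrac A) (frac y x) -> integral (tofrac A) (frac z x) ->
    exists w : A, tofrac A w = frac (y * z) x.

Definition is_submodule (R : comPzRingType) (V : lmodType R) (N : set V) :=
  [/\ N 0, (forall u v, N u -> N v -> N (u + v)) &
      (forall a v, N v -> N (a *: v))].

Definition finitely_generated (R : comPzRingType) (V : lmodType R) (N : set V) :=
  exists (n : nat) (g : 'I_n -> V),
    N = [set v | exists c : 'I_n -> R, v = \sum_(i < n) c i *: g i].

Definition noetherian (R : comPzRingType) : Prop :=
  forall I : set R^o, is_submodule I -> finitely_generated I.

Definition torsion_free (R : comPzRingType) (M : lmodType R) : Prop :=
  forall s : R, nonzerodivisor s -> forall m : M, s *: m = 0 -> m = 0.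

Module BaseChange.
Section BaseChange.
Variables (R K : comPzRingType) (f : {rmorphism R -> K}) (M : lmodType R).

(* A sequence of pairs (q, m) stands for the formal sum of the q ⊗ m. *)
Definition formal : Type := seq (K * M).
HB.instance Definition _ := Choice.on formal.

(* The additive congruence generated by the tensor relations; the inverse of
   q ⊗ m is (- q) ⊗ m. *)
Inductive rel : formal -> formal -> Prop :=
| rel_refl s : rel s s
| rel_sym s t : rel s t -> rel t s
| rel_trans s t u : rel s t -> rel t u -> rel s u
| rel_cat s s' t t' : rel s s' -> rel t t' -> rel (s ++ t) (s' ++ t')
| rel_catC s t : rel (s ++ t) (t ++ s)
| rel_0l m : rel [:: (0, m)] [::]
| rel_Dl q q' m : rel [:: (q + q', m)] [:: (q, m); (q', m)]
| rel_Dr q m m' : rel [:: (q, m + m')] [:: (q, m); (q, m')]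
| rel_bal q a m : rel [:: (q * f a, m)] [:: (q, a *: m)].

Definition relb (s t : formal) : bool := `[< rel s t >].

Lemma relb_refl : reflexive relb.
Proof. by move=> s; apply/asboolP/rel_refl. Qed.
Lemma relb_sym : symmetric relb.
Proof. by move=> s t; apply/asboolP/asboolP; apply: rel_sym. Qed.
Lemma relb_trans : transitive relb.
Proof. by move=> t s u /asboolP h /asboolP h'; apply/asboolP/(rel_trans h). Qed.

Canonical relb_equiv := EquivRel relb relb_refl relb_sym relb_trans.

Definition type := {eq_quot relb}.
HB.instance Definition _ : EqQuotient _ relb type := EqQuotient.on type.
HB.instance Definition _ := Choice.on type.

Definition cls (s : formal) : type := \pi_type s.
Definition pure (q : K) (m : M) : type := cls [:: (q, m)].

Lemma clsE s t : cls s = cls t <-> rel s t.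
Proof. by split=> [/eqmodP/asboolP //|e]; apply/eqmodP/asboolP. Qed.

Lemma clsP (x : type) : exists s, x = cls s.
Proof. by elim/quotW: x => s; exists s. Qed.

Lemma rel_repr s : rel (repr (cls s)) s.
Proof. by apply/clsE; apply: reprK. Qed.

Definition scalef (c : K) (s : formal) : formal := [seq (c * p.1, p.2) | p <- s].

Lemma scalef_rel c s t : rel s t -> rel (scalef c s) (scalef c t).
Proof.
elim=> {s t} /=.
- by move=> s; apply: rel_refl.
- by move=> s t _; apply: rel_sym.
- by move=> s t u _ h _; apply: rel_trans.
- by move=> s s' t t' _ h _ h'; rewrite /scalef !map_cat; apply: rel_cat.
- by move=> s t; rewrite /scalef !map_cat; apply: rel_catC.
- by move=> m; rewrite mulr0; apply: rel_0l.
- by move=> q q' m; rewrite mulrDr; apply: rel_Dl.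
- by move=> q m m'; apply: rel_Dr.
- by move=> q a m; rewrite mulrA; apply: rel_bal.
Qed.

Definition add (x y : type) : type := cls (repr x ++ repr y).
Definition scale (c : K) (x : type) : type := cls (scalef c (repr x)).
Definition opp (x : type) : type := scale (- 1) x.

Lemma addE s t : add (cls s) (cls t) = cls (s ++ t).
Proof. by apply/clsE/rel_cat; apply: rel_repr. Qed.
Lemma scaleE c s : scale c (cls s) = cls (scalef c s).
Proof. exact/clsE/scalef_rel/rel_repr. Qed.

Lemma addA : associative add.
Proof.
move=> x y z; have [[s ->] [t ->] [u ->]] := And3 (clsP x) (clsP y) (clsP z).
by rewrite !addE catA.
Qed.
Lemma addC : commutative add.
Proof.
move=> x y; have [[s ->] [t ->]] := conj (clsP x) (clsP y).
by rewrite !addE; apply/clsE/rel_catC.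
Qed.
Lemma add0l : left_id (cls [::]) add.
Proof. by move=> x; have [s ->] := clsP x; rewrite addE. Qed.

Lemma pureDl q q' m : pure (q + q') m = add (pure q m) (pure q' m).
Proof. by rewrite addE; apply/clsE/rel_Dl. Qed.

Lemma cls_scale_cons e p s :
  cls (scalef e (p :: s)) = add (pure (e * p.1) p.2) (cls (scalef e s)).
Proof. by rewrite addE. Qed.

Lemma scaleDl_cls s c d :
  scale (c + d) (cls s) = add (scale c (cls s)) (scale d (cls s)).
Proof.
rewrite !scaleE; elim: s => [|p s IH]; first by rewrite addE.
rewrite !cls_scale_cons IH mulrDl pureDl -!addA; congr add.
by rewrite !addA; congr add; apply: addC.
Qed.

Lemma scale0 x : scale 0 x = cls [::].
Proof.
have [s ->] := clsP x; rewrite scaleE; elim: s => [//|p s IH].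
by rewrite cls_scale_cons IH mul0r addE; apply/clsE/rel_0l.
Qed.

Lemma scale1 : left_id 1 scale.
Proof.
move=> x; have [s ->] := clsP x; rewrite scaleE /scalef; congr cls.
by rewrite -[RHS]map_id; apply: eq_map => -[q m] /=; rewrite mul1r.
Qed.

Lemma scaleDl x : {morph scale^~ x : c d / c + d >-> add c d}.
Proof. by move=> c d; have [s ->] := clsP x; apply: scaleDl_cls. Qed.

Lemma addNl : left_inverse (cls [::]) opp add.
Proof.
by move=> x; rewrite /opp -[X in add _ X]scale1 -scaleDl addNr scale0.
Qed.

HB.instance Definition _ := GRing.isZmodule.Build type addA addC add0l addNl.

Lemma scaleA c d x : scale c (scale d x) = scale (c * d) x.
Proof.
have [s ->] := clsP x; rewrite !scaleE /scalef -map_comp; congr cls.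
by apply: eq_map => -[q m] /=; rewrite mulrA.
Qed.

Lemma scaleDr : right_distributive scale +%R.
Proof.
move=> c x y; have [[s ->] [t ->]] := conj (clsP x) (clsP y).
by rewrite -[_ + _]/(add _ _) -[RHS]/(add _ _) addE !scaleE addE /scalef map_cat.
Qed.

HB.instance Definition _ :=
  GRing.Zmodule_isLmodule.Build K type scaleA scale1 scaleDr scaleDl.

Lemma pure_scale c q m : c *: pure q m = pure (c * q) m.
Proof. exact: scaleE. Qed.

Lemma pure_addl m : {morph pure^~ m : q q' / q + q'}.
Proof. by move=> q q'; apply: pureDl. Qed.

Lemma pure_addr q : {morph pure q : m m' / m + m'}.
Proof.
by move=> m m'; rewrite -[RHS]/(add _ _) addE; apply/clsE/rel_Dr.
Qed.

Lemma pure_bal q a m : pure (q * f a) m = pure q (a *: m).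
Proof. exact/clsE/rel_bal. Qed.

Lemma pure_span (x : type) :
  exists s : seq (K * M), x = \sum_(p <- s) pure p.1 p.2.
Proof.
have [s ->] := clsP x; exists s; elim: s => [|[q m] s IH]; first by rewrite big_nil.
by rewrite big_cons -IH -[RHS]/(add _ _) addE.
Qed.

Lemma universal (V : zmodType) (b : K -> M -> V) :
    (forall q q' m, b (q + q') m = b q m + b q' m) ->
    (forall q m m', b q (m + m') = b q m + b q m') ->
    (forall q a m, b (q * f a) m = b q (a *: m)) ->
  exists g : {additive type -> V}, forall q m, g (pure q m) = b q m.
Proof.
move=> bDl bDr bb; pose g0 (s : formal) := \sum_(p <- s) b p.1 p.2.
have g0E s t : rel s t -> g0 s = g0 t.
  elim=> {s t} //.
  - by move=> s t u _ -> _ ->.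
  - by move=> s s' t t' _ e _ e'; rewrite /g0 !big_cat /=; congr (_ + _).
  - by move=> s t; rewrite /g0 !big_cat /= addrC.
  - move=> m; rewrite /g0 big_seq1 big_nil /=.
    by apply: (addrI (b 0 m)); rewrite -bDl !addr0.
  - by move=> q q' m; rewrite /g0 !big_cons !big_nil /= !addr0 bDl.
  - by move=> q m m'; rewrite /g0 !big_cons !big_nil /= !addr0 bDr.
  - by move=> q a m; rewrite /g0 !big_seq1 /= bb.
pose g (x : type) := g0 (repr x).
have gE s : g (cls s) = g0 s by apply/g0E/rel_repr.
have gD : {morph g : x y / x + y}.
  move=> x y; have [[s ->] [t ->]] := conj (clsP x) (clsP y).
  by rewrite -[_ + _]/(add _ _) addE !gE /g0 big_cat.
have gB : zmod_morphism g.
  by move=> x y; apply: (addIr (g y)); rewrite -gD !subrK.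
pose ga := GRing.isZmodMorphism.Build type V g gB.
pose G : {additive type -> V} := HB.pack g ga.
by exists G => q m; rewrite [G _]gE /g0 big_seq1.
Qed.

End BaseChange.
End BaseChange.
HB.export BaseChange.

Notation base_change := BaseChange.type.
Notation pure := BaseChange.pure.

(* The subset C · N of a K-module T, for C ⊆ K and N ⊆ T. *)
Definition span_prod (K : comPzRingType) (T : lmodType K) (C : set K) (N : set T)
    : set T :=
  [set t | exists (n : nat) (c : 'I_n -> K) (x : 'I_n -> T),
     [/\ forall i, C (c i), forall i, N (x i) & t = \sum_(i < n) c i *: x i]].

(* The R-submodule of Q(R) ⊗ M with which M is identified; the map from M is
   injective when M is torsion-free. *)
Definition module_image (R : comPzRingType) (M : lmodType R) :
    set (base_change (tofrac R) M) :=
  range (fun m : M => pure (tofrac R) 1 m).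

Definition is_intclosure_module (R : comPzRingType) (M : lmodType R) : Prop :=
  span_prod (@intclosure R) (@module_image R M) = @module_image R M.

Definition idealization (R : comPzRingType) (M : lmodType R) : Type :=
  (R * M)%type.

Section Idealization.
Variables (R : comPzRingType) (M : lmodType R).

HB.instance Definition _ := GRing.Zmodule.on (idealization M).

Implicit Types p q : idealization M.

Definition idealization_one : idealization M := (1, 0).
Definition idealization_mul p q : idealization M :=
  (p.1 * q.1, q.1 *: p.2 + p.1 *: q.2).

Lemma idealization_mulA : associative idealization_mul.
Proof.
move=> [a x] [b y] [c z]; rewrite /idealization_mul /=; congr pair.
  by rewrite mulrA.
by rewrite !scalerDr !scalerA addrA (mulrC c b) (mulrC c a).
Qed.

Lemma idealization_mulC : commutative idealization_mul.
Proof.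
move=> [a x] [b y]; rewrite /idealization_mul /=; congr pair.
  by rewrite mulrC.
by rewrite addrC.
Qed.

Lemma idealization_mul1l : left_id idealization_one idealization_mul.
Proof.
by move=> [a x]; rewrite /idealization_mul /= mul1r scaler0 add0r scale1r.
Qed.

Lemma idealization_mulDl : left_distributive idealization_mul +%R.
Proof.
move=> [a x] [b y] [c z]; rewrite /idealization_mul /=; congr pair => /=.
  by rewrite mulrDl.
by rewrite scalerDr scalerDl addrACA.
Qed.

HB.instance Definition _ := GRing.Zmodule_isComPzRing.Build (idealization M)
  idealization_mulA idealization_mulC idealization_mul1l idealization_mulDl.

End Idealization.

(* Main.v *)
From HB Require Import structures.
From mathcomp Require Import all_boot all_algebra.
From mathcomp Require Import boolp classical_sets.
Require Import Defs.

(** Write [A] for the idealization of [M].  All fractions are handled through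
    equations between their numerators and denominators.

    An element [(s, m)] of [A] is a non-zerodivisor exactly when [s] is one in
    [R] (torsion-freeness of [M] gives the converse half), and both ring
    morphisms [R -> A] and [A -> R] transport integral equations of fractions:
    clearing denominators in a monic equation of [y / x] leaves a homogeneous
    equation between [y] and [x], which any ring morphism preserves
    ([integral_frac_rmorph]).  On the other side, [M] is a module over the
    integral closure of [R] exactly when, for all integral [b / s] and all [m],
    the element [b *: m] is divisible by [s] in [M]
    ([is_intclosure_moduleP]); this rests on the injectivity of the map from
    [M] to its base change.

    If [A] is weakly Arf, then [R] inherits the property through the two
    morphisms.  Moreover [(0, m) / (s, 0)] has square zero, hence is integral,
    so that the product of [(b, 0)] and [(0, m)], which is [(0, b *: m)], is
    divisible by [(s, 0)] in [A]: this is the divisibility wanted in [M].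

    Conversely let [y = (b, n)], [z = (c, l)] and [x = (s, m)], with [y / x]
    and [z / x] integral; then [b / s] and [c / s] are integral over [R].  The
    element [y * z / x] has first component [b * c / s], which lies in [R] as
    [R] is weakly Arf, and second component
    [(b / s) *: l + (c / s) *: n - (b / s) *: ((c / s) *: m)],
    which lies in [M] as [M] is stable under multiplication by [b / s] and
    [c / s]. *)

Set Implicit Arguments.
Unset Strict Implicit.
Unset Printing Implicit Defensive.

Import GRing.Theory.
Local Open Scope ring_scope.

Section Fractions.
Variable A : comPzRingType.
Implicit Types (x : nzd A) (y : A).

Lemma tofrac_nzdI x (u v : total_frac A) :
  tofrac A x * u = tofrac A x * v -> u = v.
Proof.
have e : frac 1 x * tofrac A x = 1 by rewrite mulrC frac_mull rmorph1.
by move=> h; rewrite -(mul1r u) -e -mulrA h mulrA e mul1r.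
Qed.

Lemma tofrac_eq_frac (w y : A) x : tofrac A w = frac y x <-> w * (x : A) = y.
Proof.
split=> [/TotalFrac.fracE /=|e]; first by rewrite mulr1.
by apply/TotalFrac.fracE; rewrite /= mulr1.
Qed.

Lemma integral_fracP y x :
  integral (tofrac A) (frac y x) <->
  exists (n : nat) (c : 'I_n -> A),
    y ^+ n + \sum_(i < n) c i * (y ^+ i * (x : A) ^+ (n - i)) = 0.
Proof.
have powE n i : (i <= n)%N ->
    tofrac A x ^+ n * frac y x ^+ i = tofrac A (y ^+ i * (x : A) ^+ (n - i)).
  move=> le_in; rewrite -{1}(subnK le_in) exprD -mulrA -exprMn frac_mull.
  by rewrite -!rmorphXn -rmorphM /= mulrC.
have clear n (c : 'I_n -> A) :
    tofrac A x ^+ n *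
      (frac y x ^+ n + \sum_(i < n) tofrac A (c i) * frac y x ^+ i) =
    tofrac A (y ^+ n + \sum_(i < n) c i * (y ^+ i * (x : A) ^+ (n - i))).
  rewrite mulrDr powE // subnn mulr1 rmorphD rmorph_sum mulr_sumr /=.
  congr (_ + _); apply: eq_bigr => i _.
  by rewrite mulrCA powE ?rmorphM // ltnW.
have cancelX n (u : total_frac A) : tofrac A x ^+ n * u = 0 -> u = 0.
  elim: n => [|n IHn]; first by rewrite mul1r.
  by rewrite exprS -mulrA => e; apply/IHn/(@tofrac_nzdI x); rewrite e mulr0.
split=> -[n [c e]]; exists n, c.
  by apply: tofrac_inj; rewrite -clear e mulr0 rmorph0.
by apply: (cancelX n); rewrite clear e rmorph0.
Qed.

(** Nilpotent elements of the total ring of fractions are integral; square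
    zero is the case that occurs. *)
Lemma integral_frac_sqr0 y x : y ^+ 2 = 0 -> integral (tofrac A) (frac y x).
Proof.
move=> y2; apply/integral_fracP; exists 2, (fun=> 0).
by rewrite y2 add0r big1 // => i _; rewrite mul0r.
Qed.

End Fractions.

(** The homogeneous form of an integral equation makes sense in the rings
    themselves, so that [f] can be applied to it directly, without being
    extended to the total rings of fractions. *)
Lemma integral_frac_rmorph (A B : comPzRingType) (f : {rmorphism A -> B})
    (y : A) (x : nzd A) (x' : nzd B) :
  f (x : A) = (x' : B) -> integral (tofrac A) (frac y x) ->
  integral (tofrac B) (frac (f y) x').
Proof.
move=> fx /integral_fracP[n [c e]]; apply/integral_fracP.
exists n, (fun i => f (c i)); rewrite -[RHS](rmorph0 f) -{}e.
rewrite rmorphD rmorph_sum rmorphXn -fx; congr (_ + _).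
by apply: eq_bigr => i _; rewrite !rmorphM !rmorphXn.
Qed.

Section Idealization.
Variables (R : comPzRingType) (M : lmodType R).
Local Notation A := (idealization M).

Lemma idealizationM (p q : A) :
  p * q = (p.1 * q.1, q.1 *: p.2 + p.1 *: q.2) :> A.
Proof. by []. Qed.

Definition idealization_inl (a : R) : A := (a, 0).
Definition idealization_inr (m : M) : A := (0, m).
Definition idealization_proj (p : A) : R := p.1.

Lemma idealization_inl_is_zmod_morphism : zmod_morphism idealization_inl.
Proof. by move=> a b; congr pair => /=; rewrite subrr. Qed.
HB.instance Definition _ := GRing.isZmodMorphism.Build R A idealization_inl
  idealization_inl_is_zmod_morphism.

Lemma idealization_inl_is_monoid_morphism : monoid_morphism idealization_inl.
Proof.
by split=> // a b; rewrite idealizationM /= !scaler0 addr0.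
Qed.
HB.instance Definition _ := GRing.isMonoidMorphism.Build R A idealization_inl
  idealization_inl_is_monoid_morphism.

Lemma idealization_proj_is_zmod_morphism : zmod_morphism idealization_proj.
Proof. by []. Qed.
HB.instance Definition _ := GRing.isZmodMorphism.Build A R idealization_proj
  idealization_proj_is_zmod_morphism.

Lemma idealization_proj_is_monoid_morphism : monoid_morphism idealization_proj.
Proof. by []. Qed.
HB.instance Definition _ := GRing.isMonoidMorphism.Build A R idealization_proj
  idealization_proj_is_monoid_morphism.

Lemma idealization_inr_sqr0 m : idealization_inr m ^+ 2 = 0.
Proof. by rewrite expr2 idealizationM /= mulr0 !scale0r addr0. Qed.

Lemma idealization_inlr a m :
  idealization_inl a * idealization_inr m = idealization_inr (a *: m).
Proof. by rewrite idealizationM /= mulr0 scale0r add0r. Qed.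

(** If [s * b = 0], then [(s, m) * (b, 0) = (0, b *: m)] is itself killed by
    [(s, m)]; so cancelling [(s, m)] twice gives [b = 0]. *)
Lemma nonzerodivisor_proj (p : A) :
  nonzerodivisor p -> nonzerodivisor (idealization_proj p).
Proof.
case: p => s m p_nzd b /= sb0.
have bm : ((s, m) : A) * idealization_inl b = idealization_inr (b *: m).
  by rewrite idealizationM /= scaler0 addr0 sb0.
have: idealization_inr (b *: m) = 0.
  apply: p_nzd; rewrite idealizationM /= mulr0 scale0r add0r scalerA sb0.
  by rewrite scale0r.
by rewrite -bm => /p_nzd[].
Qed.

Definition nzd_proj (x : nzd A) : nzd R :=
  Nzd (asboolT (nonzerodivisor_proj (@nzdP _ x))).

Hypothesis M_tf : torsion_free M.

Lemma nonzerodivisor_inl (s : R) :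
  nonzerodivisor s -> nonzerodivisor (idealization_inl s).
Proof.
move=> s_nzd [b n]; rewrite idealizationM /= scaler0 add0r => -[/s_nzd -> sn0].
by rewrite (M_tf s_nzd sn0).
Qed.

Definition nzd_inl (s : nzd R) : nzd A :=
  Nzd (asboolT (nonzerodivisor_inl (@nzdP _ s))).

(** The total ring of fractions of the idealization contains the base change
    of [M] to the total ring of fractions of [R]; it serves as the target that
    detects the elements of [M], by the universal property of the base
    change. *)
Lemma pure1_inj : injective (fun m : M => pure (tofrac R) 1 m).
Proof.
(* [phi] is the map that the inclusion of [R] in [A] induces on fractions. *)
have phi_ex (q : total_frac R) : exists v : total_frac A, forall a s,
    q = frac a s -> v = frac (idealization_inl a) (nzd_inl s).
  have [b [t ->]] := TotalFrac.fracP q.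
  exists (frac (idealization_inl b) (nzd_inl t)) => a s /TotalFrac.fracE e.
  by apply/TotalFrac.fracE; rewrite /= -!rmorphM /= e.
have [phi phiP] := choice phi_ex.
have phiE a s : phi (frac a s) = frac (idealization_inl a) (nzd_inl s).
  exact: phiP.
have phi_tofrac a : phi (tofrac R a) = tofrac A (idealization_inl a).
  by rewrite [phi _]phiE; apply/TotalFrac.fracE.
have phiD : {morph phi : q r / q + r}.
  move=> q r; have [a [s ->]] := TotalFrac.fracP q.
  have [b [t ->]] := TotalFrac.fracP r.
  rewrite -[_ + _]/(TotalFrac.add _ _) TotalFrac.addE !phiE.
  rewrite -[RHS]/(TotalFrac.add _ _) TotalFrac.addE; apply/TotalFrac.fracE => /=.
  by rewrite -!rmorphM -rmorphD -!rmorphM.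
have phiM : {morph phi : q r / q * r}.
  move=> q r; have [a [s ->]] := TotalFrac.fracP q.
  have [b [t ->]] := TotalFrac.fracP r.
  rewrite -[_ * _]/(TotalFrac.mul _ _) TotalFrac.mulE !phiE.
  rewrite -[RHS]/(TotalFrac.mul _ _) TotalFrac.mulE; apply/TotalFrac.fracE => /=.
  by rewrite -!rmorphM.
have inrD (m m' : M) :
    idealization_inr (m + m') = idealization_inr m + idealization_inr m'.
  by congr pair => /=; rewrite addr0.
have [|||g gE] := @BaseChange.universal _ _ (tofrac R) M (total_frac A)
    (fun q m => phi q * tofrac A (idealization_inr m)).
- by move=> q r m; rewrite phiD mulrDl.
- by move=> q m m'; rewrite inrD rmorphD mulrDr.
- by move=> q a m; rewrite phiM phi_tofrac -mulrA -rmorphM idealization_inlr.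
move=> m m' /= /(congr1 g); rewrite !gE -(rmorph1 (tofrac R)) phi_tofrac.
by rewrite !rmorph1 !mul1r => /tofrac_inj[].
Qed.

(** This turns the statement about subsets of the base change into a
    divisibility property inside [M]. *)
Lemma is_intclosure_moduleP :
  is_intclosure_module M <->
  forall (b : R) (s : nzd R) (m : M), integral (tofrac R) (frac b s) ->
    exists m', (s : R) *: m' = b *: m.
Proof.
pose i (m : M) := pure (tofrac R) 1 m.
have i_scale a m : tofrac R a *: i m = i (a *: m).
  by rewrite /i BaseChange.pure_scale -BaseChange.pure_bal mulrC.
have frac_scale b (s : nzd R) m m' :
    frac b s *: i m = i m' <-> (s : R) *: m' = b *: m.
  split=> [e | e].
    by apply: pure1_inj; rewrite -/(i _) -/(i _) -!i_scale -e scalerA frac_mull.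
  have us : frac 1 s * tofrac R s = 1 by rewrite mulrC frac_mull rmorph1.
  rewrite -[LHS]scale1r -[RHS]scale1r -us -[LHS]scalerA -[RHS]scalerA.
  by rewrite [tofrac R s *: (_ *: _)]scalerA frac_mull !i_scale e.
have i_add : {morph i : m n / m + n} by apply: BaseChange.pure_addr.
have i0 : i 0 = 0 by apply: (addrI (i 0)); rewrite -i_add !addr0.
rewrite /is_intclosure_module; split=> [eqM b s m bs|divM].
  have: module_image (M := M) (frac b s *: i m).
    rewrite -eqM; exists 1, (fun=> frac b s), (fun=> i m).
    by split=> [//|_|]; [exists m | rewrite big_ord1].
  by move=> [m' _ e]; exists m'; apply/frac_scale; rewrite -e.
apply/seteqP; split=> [_ [n [c [x [c_int xM ->]]]]|_ [m _ <-]].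
  elim/big_ind: _ => [|_ _ [m _ <-] [m' _ <-]|j _].
  - by exists 0.
  - by exists (m + m'); rewrite // [LHS]i_add.
  have [m _ <-] := xM j; have := c_int j.
  have [b [s ->]] := TotalFrac.fracP (c j) => /(divM b s m)[m' e].
  by exists m' => //; apply/esym/frac_scale.
(* The other inclusion holds as [1] is a root of ['X - 1], hence integral. *)
exists 1, (fun=> 1), (fun=> i m); split=> [_|_|].
- exists 1, (fun=> - 1); rewrite big_ord1 !expr1 rmorphN1 mulr1.
  by rewrite subrr.
- by exists m.
- by rewrite big_ord1 scale1r.
Qed.

End Idealization.

Theorem theorem1p4 (R : comPzRingType) (M : lmodType R) :
  noetherian R ->
  finitely_generated [set: M]%classic ->
  torsion_free M ->
  weakly_Arf (idealization M) <-> (weakly_Arf R /\ is_intclosure_module M).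
Proof.
move=> _ _ M_tf; pose A := idealization M.
have inl_int (y : R) (s : nzd R) : integral (tofrac R) (frac y s) ->
    integral (tofrac A) (frac (idealization_inl M y) (nzd_inl M_tf s)).
  exact: (integral_frac_rmorph (f := idealization_inl M)).
have proj_int (y : A) (x : nzd A) : integral (tofrac A) (frac y x) ->
    integral (tofrac R) (frac (idealization_proj y) (nzd_proj x)).
  exact: (integral_frac_rmorph (f := @idealization_proj R M)).
split=> [arfA|[arfR /(is_intclosure_moduleP M_tf) divM] x y z yx zx].
  split=> [x y z /inl_int yx /inl_int zx|].
    have [w /tofrac_eq_frac e] := arfA _ _ _ yx zx.
    exists (idealization_proj w); apply/tofrac_eq_frac.
    by have := congr1 (@idealization_proj R M) e; rewrite !rmorphM.
  apply/(is_intclosure_moduleP M_tf) => b s m /inl_int bs.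
  have zs := integral_frac_sqr0 (nzd_inl M_tf s) (idealization_inr_sqr0 m).
  have [w /tofrac_eq_frac] := arfA _ _ _ bs zs.
  rewrite idealization_inlr idealizationM /= scaler0 addr0 => -[_ e].
  by exists w.2; rewrite -e.
have {}yx := proj_int _ _ yx; have {}zx := proj_int _ _ zx.
have [d /tofrac_eq_frac ds] := arfR _ _ _ yx zx.
have [l' el] := divM _ _ z.2 yx; have [n' en] := divM _ _ y.2 zx.
have [m' em] := divM _ _ (nzd_val x).2 zx; have [m'' em'] := divM _ _ m' yx.
exists (d, l' + n' - m''); apply/tofrac_eq_frac; rewrite !idealizationM /=.
move: (@nzdP _ (nzd_proj x)) ds el en em em'; rewrite /= /idealization_proj.
case: y z (nzd_val x) {yx zx} => [b n] [c l] [s m] /=.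
move=> s_nzd ds el en em em'; congr pair => //.
(* Both sides of [s *: m'' = d *: m] agree after multiplication by [s]. *)
have sm'' : s *: m'' = d *: m.
  apply/eqP; rewrite -subr_eq0; apply/eqP/(M_tf _ s_nzd).
  by rewrite scalerBr em' !scalerA !(mulrC s) ds -!scalerA em subrr.
by rewrite scalerBr scalerDr el en sm'' subrK addrC.
Qed.
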